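(* Let $\mathcal R$ be an associative unital algebra over $\mathbb C$, $M$ an $n\times n$ matrix over $\mathcal R$, and $t$ a formal variable commuting with all elements of $\mathcal R$. (i) Suppose $M$ is a Manin matrix, write $\det^{column}(t-M)=\sum_{k=0}^n h_k t^k$ with $h_k\in\mathcal R$, and put $h_k=0$ for $k<0$. Then $$\partial_t \det{}^{column}(t-M)=\frac1t\,\bigl(\det{}^{column}(t-M)\bigr)\sum_{k=0}^{\infty}\mathrm{Tr}\bigl((M/t)^k\bigr)$$ as formal series in $t^{-1}$ with finitely many positive powers of $t$; equivalently, for every integer $k\le n$, $$k\,h_k=\sum_{i:\ \max(0,-k)\le i\le n-k} h_{k+i}\,\mathrm{Tr}(M^i).$$ (ii) If the transpose $M^t$ is a Manin matrix, then $$\partial_t \det{}^{row}(t-M)=\Bigl(\frac1t\sum_{k=0}^{\infty}\mathrm{Tr}\bigl((M/t)^k\bigr)\Bigr)\det{}^{row}(t-M).$$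
   Context: A matrix $M$ with entries $M_{ij}$ in a (not necessarily commutative) associative ring is called a Manin matrix if (1) elements in the same column commute with each other, and (2) $[M_{ij},M_{kl}]=[M_{kj},M_{il}]$ for all $i,j,k,l$. For an $n\times n$ matrix $N$: $\det^{column}N=\sum_{\sigma\in S_n}(-1)^{\sigma}N_{\sigma(1),1}N_{\sigma(2),2}\cdots N_{\sigma(n),n}$ and $\det^{row}N=\sum_{\sigma\in S_n}(-1)^{\sigma}N_{1,\sigma(1)}N_{2,\sigma(2)}\cdots N_{n,\sigma(n)}$. Here $t-M$ means $t\cdot\mathrm{Id}-M$. *)

(* Defs.v *)
From HB Require Import structures.
From mathcomp Require Import all_boot all_order all_fingroup all_algebra zify.
From mathcomp Require Import complex.
From mathcomp Require Import all_classical reals.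

Set Implicit Arguments.
Unset Strict Implicit.
Unset Printing Implicit Defensive.

Import Order.TTheory GRing.Theory Num.Theory.
Local Open Scope classical_set_scope.
Local Open Scope ring_scope.

Section ManinDet.
Variable R : pzRingType.

Definition lie_bracket (x y : R) : R := x * y - y * x.

Definition manin m n (M : 'M[R]_(m, n)) : Prop :=
  (forall i j k, GRing.comm (M i j) (M k j)) /\
  (forall i j k l,
     lie_bracket (M i j) (M k l) = lie_bracket (M k j) (M i l)).

(* The entries do not commute: the factors of each product are taken in
   increasing order of the index i. *)
Definition coldet n (N : 'M[R]_n) : R :=
  \sum_(s : 'S_n) (-1) ^+ s * \prod_(i < n) N (s i) i.

Definition rowdet n (N : 'M[R]_n) : R :=
  \sum_(s : 'S_n) (-1) ^+ s * \prod_(i < n) N i (s i).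

End ManinDet.

Section Laurent.
Variable R : nzRingType.

(* Formal series in t^-1 with finitely many positive powers of t, as
   coefficient functions: f k is the coefficient of t^k. *)
Definition vanish_above (a : int) (f : int -> R) : Prop :=
  forall k, a < k -> f k = 0.

Definition bounded_above : pred (int -> R) :=
  fun f => `[< exists a, vanish_above a f >].

Lemma bounded_aboveP (f : int -> R) :
  reflect (exists a, vanish_above a f) (f \in bounded_above).
Proof. exact: asboolP. Qed.

Lemma bounded_above_zmod : zmod_closed bounded_above.
Proof.
split=> [|f g /bounded_aboveP[a fa] /bounded_aboveP[b gb]].
  by apply/bounded_aboveP; exists 0.
apply/bounded_aboveP; exists (Num.max a b) => k; rewrite gt_max => /andP[ka kb].
by rewrite -[LHS]/(f k - g k) fa// gb// subr0.
Qed.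

HB.instance Definition _ :=
  GRing.isZmodClosed.Build (int -> R) bounded_above bounded_above_zmod.

Record laurent := Laurent {
  lcoef :> int -> R;
  _ : lcoef \in bounded_above }.

HB.instance Definition _ := [isSub for lcoef].
HB.instance Definition _ := [Choice of laurent by <:].
HB.instance Definition _ := [SubChoice_isSubZmodule of laurent by <:].

(* In the definitions below, insubd 0 f is the series with coefficients f
   (and 0 if f is not bounded above). *)

(* Cauchy product; the sum over all of int has finite support. *)
Definition lmul_coef (f g : int -> R) (k : int) : R :=
  \sum_(i \in [set: int]) f i * g (k - i).

Definition lmul (f g : laurent) : laurent := insubd 0 (lmul_coef f g).

(* Polynomials in t, regarded as coefficient functions extended by 0 to
   negative exponents, and as Laurent series. *)
Definition pcoef (p : {poly R}) (k : int) : R :=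
  if k is Posz m then p`_m else 0.

Definition lpoly (p : {poly R}) : laurent := insubd 0 (pcoef p).

Definition lconst (c : R) : laurent := lpoly c%:P.

(* t^k, for k of any sign. *)
Definition lvar (k : int) : laurent := insubd 0 (fun m => (m == k)%:R).

(* Infinite sum of a sequence of series, coefficient by coefficient; meaningful
   when each power of t occurs in finitely many u i and the result is bounded
   above. *)
Definition lsum (u : nat -> laurent) : laurent :=
  insubd 0 (fun k => \sum_(i \in [set: nat]) u i k).

Lemma lcoef_insubd (f : int -> R) :
  f \in bounded_above -> lcoef (insubd 0 f) = f.
Proof. by move=> fb; rewrite -[LHS]/(val _) insubdK. Qed.

Lemma laurentP (f g : laurent) : (forall k, f k = g k) -> f = g.
Proof. by move=> fg; apply: val_inj; apply/funext. Qed.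

Lemma laurent_bound (f : laurent) : exists a, vanish_above a f.
Proof. by apply/bounded_aboveP; case: f. Qed.

(* Up to a shift of the exponents, a product coefficient is a coefficient of a
   product of polynomial truncations. *)
Definition ltrunc (f : int -> R) (a : int) (d : nat) : {poly R} :=
  \poly_(i < d) f (a - i%:Z).

Lemma lmul_coef_vanish a b f g :
  vanish_above a f -> vanish_above b g -> vanish_above (a + b) (lmul_coef f g).
Proof.
move=> fa gb k abk; apply: fsbig1 => i _.
have [ia|ai] := leP i a; last by rewrite fa ?mul0r.
by rewrite gb ?mulr0 ?eqxx//; lia.
Qed.

Lemma lmul_coef_poly (f g : int -> R) (a b : int) (d j : nat) :
    vanish_above a f -> vanish_above b g -> (j < d)%N ->
  lmul_coef f g (a + b - j%:Z) = (ltrunc f a d * ltrunc g b d)`_j.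
Proof.
move=> fa gb jd.
rewrite /lmul_coef (fsbigE [seq a - (i : nat)%:Z | i <- index_iota 0 j.+1]).
- rewrite big_map big_mkord coefM; apply: eq_big => [i|i _]; first by rewrite in_setT.
  rewrite !coef_poly (leq_ltn_trans (leq_ord i) jd).
  rewrite (leq_ltn_trans (leq_subr _ _) jd) -subzn ?leq_ord//.
  by congr (_ * g _); lia.
- by rewrite map_inj_uniq ?iota_uniq// => x y /addrI /oppr_inj [].
- by [].
move=> i _; apply: contraNeq => fgi; apply/mapP; exists `|(a - i)%R|%N; last first.
  rewrite gez0_abs ?subKr// subr_ge0 leNgt; apply: contraNN fgi => ai.
  by rewrite fa ?mul0r.
rewrite mem_index_iota /= ltnS -lez_nat; have [ia|ai] := leP i a; last first.
  by rewrite fa ?mul0r ?eqxx in fgi.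
rewrite gez0_abs ?subr_ge0// leNgt; apply: contraNN fgi => jai.
by rewrite gb ?mulr0 ?eqxx//; lia.
Qed.

Lemma lmulE (f g : laurent) : lcoef (lmul f g) = lmul_coef f g.
Proof.
have [[a fa] [b gb]] := (laurent_bound f, laurent_bound g).
by apply/lcoef_insubd/bounded_aboveP; exists (a + b); exact: lmul_coef_vanish.
Qed.

Lemma lvarE k m : lvar k m = (m == k)%:R.
Proof.
rewrite /lvar lcoef_insubd//; apply/bounded_aboveP; exists k => i ki.
by rewrite gt_eqF.
Qed.

Lemma vanish_aboveW a b f : a <= b -> vanish_above a f -> vanish_above b f.
Proof. by move=> ab fa k bk; rewrite fa// (le_lt_trans ab). Qed.

Lemma laurent_eq a (f g : laurent) :
    vanish_above a f -> vanish_above a g ->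
  (forall j : nat, f (a - j%:Z) = g (a - j%:Z)) -> f = g.
Proof.
move=> fa ga fg; apply: laurentP => k.
have [ka|ak] := leP k a; last by rewrite fa// ga.
by have := fg `|(a - k)%R|%N; rewrite gez0_abs ?subr_ge0// subKr.
Qed.

Lemma lmul1r : left_id (lvar 0) lmul.
Proof.
move=> g; apply: laurentP => k; rewrite lmulE /lmul_coef.
rewrite (fsbigE [:: 0])//= => [|i _].
  by rewrite big_cons big_nil in_setT lvarE eqxx mul1r subr0 addr0.
by rewrite inE lvarE => /negPf ->; rewrite mul0r.
Qed.

Lemma lmulr1 : right_id (lvar 0) lmul.
Proof.
move=> f; apply: laurentP => k; rewrite lmulE /lmul_coef.
rewrite (fsbigE [:: k])//= => [|i _].
  by rewrite big_cons big_nil in_setT lvarE subrr eqxx mulr1 addr0.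
by rewrite inE lvarE subr_eq0 eq_sym => /negPf ->; rewrite mulr0.
Qed.

Lemma ltruncD (f g : laurent) a d :
  ltrunc (f + g) a d = ltrunc f a d + ltrunc g a d.
Proof.
by apply/polyP => i; rewrite coefD !coef_poly; case: ifP; rewrite ?addr0.
Qed.

Lemma laurent_bound2 (f g : laurent) :
  exists a, [/\ vanish_above a f, vanish_above a g & vanish_above a (f + g)].
Proof.
have [[a fa] [b gb]] := (laurent_bound f, laurent_bound g).
exists (Num.max a b); split=> [||k].
- by apply: vanish_aboveW fa; rewrite le_max lexx.
- by apply: vanish_aboveW gb; rewrite le_max lexx orbT.
by rewrite gt_max => /andP[ak bk]; rewrite -[LHS]/(f k + g k) fa// gb// addr0.
Qed.

Lemma lmulDl : left_distributive lmul +%R.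
Proof.
move=> f g h; apply: laurentP => k; rewrite -[RHS]/(lmul f h k + lmul g h k).
rewrite !lmulE; have [a [fa ga fga]] := laurent_bound2 f g.
have [b hb] := laurent_bound h; have [kab|abk] := leP k (a + b); last first.
  by rewrite !(lmul_coef_vanish _ hb abk)// addr0.
have -> : k = a + b - `|(a + b - k)%R|%:Z by rewrite gez0_abs ?subr_ge0// subKr.
by rewrite !(lmul_coef_poly _ hb (ltnSn _))// ltruncD mulrDl coefD.
Qed.

Lemma lmulDr : right_distributive lmul +%R.
Proof.
move=> h f g; apply: laurentP => k; rewrite -[RHS]/(lmul h f k + lmul h g k).
rewrite !lmulE; have [a [fa ga fga]] := laurent_bound2 f g.
have [b hb] := laurent_bound h; have [kab|abk] := leP k (b + a); last first.
  by rewrite !(lmul_coef_vanish hb _ abk)// addr0.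
have -> : k = b + a - `|(b + a - k)%R|%:Z by rewrite gez0_abs ?subr_ge0// subKr.
by rewrite !(lmul_coef_poly hb _ (ltnSn _))// ltruncD mulrDr coefD.
Qed.

Lemma ltrunc_mul (f g : laurent) a b d i :
    vanish_above a f -> vanish_above b g -> (i < d)%N ->
  (ltrunc (lmul f g) (a + b) d)`_i = (ltrunc f a d * ltrunc g b d)`_i.
Proof. by move=> fa gb id; rewrite coef_poly id lmulE; exact: lmul_coef_poly. Qed.

Lemma lmulA : associative lmul.
Proof.
move=> f g h; have [a fa] := laurent_bound f.
have [[b gb] [c hc]] := (laurent_bound g, laurent_bound h).
have fgab : vanish_above (a + b) (lmul f g).
  by rewrite lmulE; exact: lmul_coef_vanish.
have ghbc : vanish_above (b + c) (lmul g h).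
  by rewrite lmulE; exact: lmul_coef_vanish.
apply: (@laurent_eq (a + b + c)) => [||j].
- by rewrite lmulE -addrA; exact: lmul_coef_vanish.
- by rewrite lmulE; exact: lmul_coef_vanish.
rewrite !(lmulE _ (lmul _ _), lmulE (lmul _ _)).
rewrite (lmul_coef_poly fgab hc (ltnSn j)).
rewrite -[a + b + c]addrA (lmul_coef_poly fa ghbc (ltnSn j)).
transitivity (ltrunc f a j.+1 * (ltrunc g b j.+1 * ltrunc h c j.+1))`_j.
  rewrite !coefM; apply: eq_bigr => i _; congr (_ * _).
  by rewrite ltrunc_mul// ltnS leq_subr.
rewrite mulrA !coefM; apply: eq_bigr => i _; congr (_ * _).
by rewrite ltrunc_mul.
Qed.

Lemma lone_neq0 : lvar 0 != 0.
Proof.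
apply/eqP => /(congr1 (fun f : laurent => f 0)).
by rewrite lvarE eqxx => /eqP; rewrite oner_eq0.
Qed.

HB.instance Definition _ := GRing.Zmodule_isNzRing.Build laurent
  lmulA lmul1r lmulr1 lmulDl lmulDr lone_neq0.

End Laurent.

(* The matrix M / t over the ring of Laurent series. *)
Definition mx_over_t (R : nzRingType) n (M : 'M[R]_n) : 'M[laurent R]_n :=
  lvar R (-1) *: map_mx (@lconst R) M.

(* det^column (t - M) and det^row (t - M), as polynomials in the central
   variable t = 'X. *)
Definition colchar_poly (R : nzRingType) n (M : 'M[R]_n) : {poly R} :=
  coldet ('X%:M - map_mx polyC M).

Definition rowchar_poly (R : nzRingType) n (M : 'M[R]_n) : {poly R} :=
  rowdet ('X%:M - map_mx polyC M).

(* Main.v *)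
(* Put [N = t - M], which is again a Manin matrix. Replacing a column of a Manin
   matrix by another of its columns, or by a constant vector, gives a Manin
   matrix, and the column determinant of Manin matrices is alternating in the
   columns. Moving column [j] to the last place, where the determinant is linear
   on the right, gives a left adjugate [A] with [A N = det N], where [A_(j,i)] is
   the determinant of [N] with column [j] replaced by [e_i]; moving it to the
   first place gives [N^T A^T = det N]. By the Leibniz rule
   [d/dt det (t - M) = Tr A], and expanding [A = (det N) (t - M)^-1] in powers of
   [1/t] gives the Newton identities. *)
Require Import Defs.
From mathcomp Require Import all_boot all_order all_fingroup all_algebra zify.
From mathcomp Require Import complex.
From mathcomp Require Import all_classical reals.

Import Order.TTheory GRing.Theory Num.Theory.
Local Open Scope ring_scope.

Set Implicit Arguments.
Unset Strict Implicit.
Unset Printing Implicit Defensive.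

(** * Column determinants of Manin matrices: alternation and Cramer's rule *)

Section ManinCramer.
Variable R : pzRingType.

Lemma manin_colsub m n p (f : 'I_p -> 'I_n) (N : 'M[R]_(m, n)) :
  manin N -> manin (colsub f N).
Proof. by move=> [Nc Nx]; split=> *; rewrite !mxE; [apply: Nc | apply: Nx]. Qed.

Lemma manin_col_perm m n (s : 'S_n) (N : 'M[R]_(m, n)) :
  manin N -> manin (col_perm s N).
Proof. by move=> [Nc Nx]; split=> *; rewrite !mxE; [apply: Nc | apply: Nx]. Qed.

Lemma enum_ord_adjacent n (a b : 'I_n) : b = a.+1 :> nat ->
  enum 'I_n = take a (enum 'I_n) ++ a :: b :: drop b.+1 (enum 'I_n).
Proof.
move=> ab; rewrite -[LHS](cat_take_drop a); congr (_ ++ _).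
rewrite (drop_nth a) ?size_enum_ord// nth_ord_enum -ab.
by rewrite (drop_nth a) ?size_enum_ord// nth_ord_enum.
Qed.

(** [A] lists the indices before [a] and [B] those after [b]. They do not depend on [F], so products
    along two permutations can be compared factor by factor. *)
Lemma prod_ord_adjacent n (a b : 'I_n) : b = a.+1 :> nat ->
  exists A B : seq 'I_n,
    [/\ a \notin A ++ B, b \notin A ++ B &
        forall F : 'I_n -> R, \prod_i F i =
          \prod_(i <- A) F i * (F a * F b) * \prod_(i <- B) F i].
Proof.
move=> ab; exists (take a (enum 'I_n)), (drop b.+1 (enum 'I_n)).
have := enum_uniq 'I_n; rewrite {1}(enum_ord_adjacent ab).
rewrite -[a :: b :: _]/([:: a; b] ++ _) uniq_catCA /= inE negb_or.
move=> /and3P[/andP[_ aAB] bAB _]; split=> // F.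
rewrite [index_enum _]unlock -enumT.
by rewrite {1}(enum_ord_adjacent ab) big_cat !big_cons /= !mulrA.
Qed.

Definition setcol m n (j : 'I_n) (v : 'I_m -> R) (N : 'M[R]_(m, n)) :
    'M[R]_(m, n) :=
  \matrix_(i, l) if l == j then v i else N i l.

(** Pairing each even [s] with [tperm a b * s] groups the determinant into 2 by 2 column minors on
    columns [a] and [b]. Adjacency makes their two factors consecutive, and the outer factors [X],
    [Y] see only the other columns, so they serve every [N']. *)
Lemma coldet_adjacent n (a b : 'I_n) (N : 'M[R]_n) : b = a.+1 :> nat ->
  exists X Y : 'S_n -> R, forall N' : 'M[R]_n,
    (forall i j, j != a -> j != b -> N' i j = N i j) ->
    coldet N' = \sum_(s : 'S_n | ~~ odd_perm s)
      X s * (N' (s a) a * N' (s b) b - N' (s b) a * N' (s a) b) * Y s.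
Proof.
move=> ab; have [A [B [aAB bAB prodE]]] := prod_ord_adjacent ab.
exists (fun s => \prod_(i <- A) N (s i) i), (fun s => \prod_(i <- B) N (s i) i).
move=> N' N'E; rewrite /coldet (bigID (fun s : 'S_n => odd_perm s)) /= addrC.
have neq_ab : a != b by apply/eqP=> /(congr1 val)/=; lia.
rewrite [X in _ + X](reindex_inj (mulgI (tperm a b))) /=.
rewrite [X in _ + X](eq_bigl (fun s : 'S_n => ~~ odd_perm s)); last first.
  by move=> s; rewrite odd_mul_tperm neq_ab addTb.
rewrite -big_split; apply: eq_bigr => s s_even /=.
rewrite odd_mul_tperm neq_ab (negPf s_even) addbF.
rewrite expr0 mul1r expr1 mulN1r !prodE !permM tpermL tpermR.
(* Away from [a] and [b], neither the swap nor the change from [N] to [N'] affects the factors. *)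
have out (C : seq 'I_n) : {subset C <= A ++ B} ->
  (\prod_(i <- C) N' (s i) i = \prod_(i <- C) N (s i) i) *
  (\prod_(i <- C) N' ((tperm a b * s)%g i) i = \prod_(i <- C) N (s i) i).
  move=> CAB; rewrite ![\prod_(i <- C) _]big_seq.
  have neqC i : i \in C -> (i != a) * (i != b).
    by move=> /CAB iAB; split; apply: contraTneq iAB => ->.
  by split; apply: eq_bigr => i /neqC[ia ib];
    rewrite ?permM ?tpermD 1?eq_sym// N'E.
have subA : {subset A <= A ++ B} by move=> i iA; rewrite mem_cat iA.
have subB : {subset B <= A ++ B} by move=> i iB; rewrite mem_cat iB orbT.
by rewrite !(out _ subA) !(out _ subB) mulrBr mulrBl.
Qed.

(** The cross relation for rows [s a], [s b] says exactly that each 2 by 2 minor changes sign when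
    its columns are exchanged. *)
Lemma coldet_tperm_adjacent n (a b : 'I_n) (N : 'M[R]_n) : b = a.+1 :> nat ->
  manin N -> coldet (col_perm (tperm a b) N) = - coldet N.
Proof.
move=> ab [_ Nx]; have [X [Y coldetE]] := coldet_adjacent N ab.
rewrite !coldetE// => [|i j ja jb]; last by rewrite mxE tpermD 1?eq_sym.
rewrite -sumrN; apply: eq_bigr => s _.
rewrite -[RHS]mulNr -[X in _ = X * _]mulrN.
congr (_ * _ * _); rewrite !mxE tpermL tpermR opprB.
have := Nx (s b) a (s a) b; rewrite /lie_bracket.
set x := _ * N (s a) b; set y := N (s a) b * _; set z := _ * N (s b) b.
set t := N (s b) b * _ => xy.
move/eqP: xy; rewrite subr_eq => /eqP ->.
by rewrite [RHS]addrAC [z - t - z]addrAC subrr add0r addrC.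
Qed.

Lemma coldet_tperm n (a b : 'I_n) (N : 'M[R]_n) : a != b ->
  manin N -> coldet (col_perm (tperm a b) N) = - coldet N.
Proof.
wlog ab : a b / (a < b)%N => [hw neq_ab mN|_].
  have [/hw->//|ba|/val_inj/eqP] := ltngtP a b; last by rewrite (negPf neq_ab).
  by rewrite tpermC; apply: hw; rewrite // eq_sym.
have [m bE] : exists m, b = (a + m).+1 :> nat by exists (b - a.+1)%N; lia.
elim: m b bE {ab} N => [|m IHm] c cE N mN.
  by apply: coldet_tperm_adjacent => //; rewrite cE addn0.
have lt_b : ((a + m).+1 < n)%N by have := ltn_ord c; lia.
pose b := Ordinal lt_b; have bc : c = b.+1 :> nat by rewrite cE addnS.
(* Induction on the distance between the columns: three shorter swaps give three sign changes. *)
have -> : (tperm a c = tperm b c * tperm a b * tperm b c)%g.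
  rewrite -{1}[tperm b c]tpermV -mulgA -conjgE tpermJ tpermL tpermD//;
  by rewrite -val_eqE /=; lia.
by rewrite !col_permM !(coldet_tperm_adjacent bc, IHm b) ?opprK//;
  do ?apply: manin_col_perm.
Qed.

(** Antisymmetry alone would only give twice the determinant equal to 0, and 2 may be a zero
    divisor. Instead the equal columns are made adjacent, where each 2 by 2 minor is a commutator
    within one column. *)
Lemma coldet_alternate n (a b : 'I_n) (N : 'M[R]_n) : a != b ->
  manin N -> (forall i, N i a = N i b) -> coldet N = 0.
Proof.
wlog ab : a b / (a < b)%N => [hw neq_ab mN Nab|_].
  have [/hw->//|ba|/val_inj/eqP] := ltngtP a b; last by rewrite (negPf neq_ab).
  by apply: (hw b a) => //; rewrite eq_sym.
wlog abS : b N ab / b = a.+1 :> nat => [hw mN Nab|mN Nab].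
  have lt_c : (a.+1 < n)%N by have := ltn_ord b; lia.
  pose c := Ordinal lt_c; have [cb|neq_cb] := eqVneq c b.
    by apply: (hw b) => //; rewrite -cb.
  apply: oppr_inj; rewrite -(coldet_tperm neq_cb mN) oppr0.
  apply: (hw c) => // [|i]; first exact: manin_col_perm.
  by rewrite !mxE tpermL tpermD// -val_eqE /= ?gtn_eqF.
have [X [Y ->//]] := coldet_adjacent N abS; apply: big1 => s _.
by case: mN => + _; rewrite !Nab => ->; rewrite subrr mulr0 mul0r.
Qed.

Lemma setcol_tperm n (j k : 'I_n) (v : 'I_n -> R) (N : 'M[R]_n) :
  col_perm (tperm j k) (setcol j v N) = setcol k v (col_perm (tperm j k) N).
Proof.
apply/matrixP => i l; rewrite !mxE; congr (if _ then _ else _).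
by rewrite (can2_eq (tpermK _ _) (tpermK _ _)) tpermL.
Qed.

(** The entry of the last column is the rightmost factor of each product, so [v] can be pulled out
    on the right. For a given [s] only [i = s ord_max] contributes. *)
Lemma coldet_setcol_last n (v : 'I_n.+1 -> R) (N : 'M[R]_n.+1) :
  coldet (setcol ord_max v N) =
  \sum_i coldet (setcol ord_max (fun l => (l == i)%:R) N) * v i.
Proof.
rewrite /coldet; under [RHS]eq_bigr do rewrite mulr_suml.
rewrite exchange_big; apply: eq_bigr => s _ /=.
rewrite (bigD1 (s ord_max)) //= [X in _ + X]big1 => [|i /negPf neq_i]; last first.
  by rewrite big_ord_recr /= !mxE eqxx eq_sym neq_i !(mulr0, mul0r).
rewrite addr0 -mulrA; congr (_ * _); rewrite !big_ord_recr /= !mxE !eqxx mulr1.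
congr (_ * _); apply: eq_bigr => i _; rewrite !mxE.
by rewrite -val_eqE /= ltn_eqF.
Qed.

Lemma coldet_setcol_first n (v : 'I_n.+1 -> R) (N : 'M[R]_n.+1) :
  coldet (setcol ord0 v N) =
  \sum_i v i * coldet (setcol ord0 (fun l => (l == i)%:R) N).
Proof.
rewrite /coldet; under [RHS]eq_bigr do rewrite mulr_sumr.
rewrite exchange_big; apply: eq_bigr => s _ /=.
rewrite (bigD1 (s ord0)) //= [X in _ + X]big1 => [|i /negPf neq_i]; last first.
  by rewrite big_ord_recl /= !mxE eqxx eq_sym neq_i !(mulr0, mul0r).
rewrite addr0 !big_ord_recl /= !mxE !eqxx mul1r !mulrA.
rewrite -(commr_sign (v _)); congr (_ * _); apply: eq_bigr => i _.
by rewrite !mxE.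
Qed.

Definition coladj n (N : 'M[R]_n) : 'M[R]_n :=
  \matrix_(j, i) coldet (setcol j (fun l => (l == i)%:R) N).

(** The new entries are 0 or 1, hence central, and every bracket involving them vanishes. *)
Lemma manin_setcol_delta m n j i (N : 'M[R]_(m, n)) :
  manin N -> manin (setcol j (fun l => (l == i)%:R) N).
Proof.
move=> [Nc Nx].
have lie_nat (b : nat) x :
    ((lie_bracket b%:R x = 0) * (lie_bracket x b%:R = 0) : Type).
  by rewrite /lie_bracket !commr_nat subrr.
split=> [p q r|p q r l]; rewrite !mxE; case: eqP => _; first exact: commr_nat.
- exact: Nc.
- by case: eqP => _; rewrite !lie_nat.
by case: eqP => _; rewrite ?lie_nat// Nx.
Qed.

Lemma coldet_setcol_tperm n (j k : 'I_n) v (N : 'M[R]_n) :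
  manin (setcol j v N) ->
  coldet (setcol j v N) =
  (-1) ^+ (j != k) * coldet (setcol k v (col_perm (tperm j k) N)).
Proof.
move=> mN; rewrite -setcol_tperm; have [->|/coldet_tperm->//] := eqVneq j k.
  by rewrite tperm1 col_perm1 mul1r.
by rewrite mulN1r opprK.
Qed.

Lemma manin_setcol_col m n (j k : 'I_n) (N : 'M[R]_(m, n)) :
  manin N -> manin (setcol j (N^~ k) N).
Proof.
suff -> : setcol j (N^~ k) N = colsub (fun l => if l == j then k else l) N.
  exact: manin_colsub.
by apply/matrixP => i l; rewrite !mxE; case: ifP.
Qed.

Lemma coldet_setcol_col n (j k : 'I_n) (N : 'M[R]_n) :
  manin N -> coldet (setcol j (N^~ k) N) = coldet N *+ (j == k).
Proof.
move=> mN; have [->|neq_jk] := eqVneq j k.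
  by congr coldet; apply/matrixP => i l; rewrite mxE; case: eqP => // ->.
apply: (coldet_alternate neq_jk) => [|i]; first exact: manin_setcol_col.
by rewrite !mxE eqxx if_same.
Qed.

Lemma mul_coladj n (N : 'M[R]_n) : manin N -> coladj N *m N = (coldet N)%:M.
Proof.
case: n N => [|n] N mN; first by apply/matrixP => - [].
(* Entry [(j, k)] of the scalar matrix is the determinant of [N] with column [j] replaced by column
   [k]. That column is moved last, expanded, and each term is moved back with the same sign. *)
apply/matrixP => j k; rewrite !mxE -coldet_setcol_col//.
rewrite (coldet_setcol_tperm ord_max) ?coldet_setcol_last ?mulr_sumr; last first.
  exact: manin_setcol_col.
apply: eq_bigr => i _; rewrite mxE mulrA -coldet_setcol_tperm//.
exact: manin_setcol_delta.
Qed.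

Lemma mul_tr_coladj n (N : 'M[R]_n) :
  manin N -> N^T *m (coladj N)^T = (coldet N)%:M.
Proof.
case: n N => [|n] N mN; first by apply/matrixP => - [].
apply/matrixP => k j; rewrite !mxE eq_sym -coldet_setcol_col//.
rewrite (coldet_setcol_tperm ord0) ?coldet_setcol_first ?mulr_sumr; last first.
  exact: manin_setcol_col.
apply: eq_bigr => i _; rewrite !mxE (coldet_setcol_tperm ord0).
  by rewrite !mulrA (commr_sign (N i k)).
exact: manin_setcol_delta.
Qed.

End ManinCramer.

(** * The matrix [t - M], the derivative of its determinant, and Newton identities *)

Section CharPoly.
Variable R : nzRingType.

Lemma lie_bracketDl_comm (T : pzRingType) (c x y : T) :
  GRing.comm c y -> lie_bracket (c + x) y = lie_bracket x y.
Proof.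
by move=> cy; rewrite /lie_bracket mulrDl mulrDr cy opprD addrACA subrr add0r.
Qed.

Lemma lie_bracketDr_comm (T : pzRingType) (c x y : T) :
  GRing.comm c x -> lie_bracket x (c + y) = lie_bracket x y.
Proof.
by move=> cx; rewrite /lie_bracket mulrDl mulrDr cx opprD addrACA subrr add0r.
Qed.

(** The entries of ['X%:M] are central and drop out of the brackets; the two minus signs cancel. *)
Lemma lie_bracket_charmx n (M : 'M[R]_n) i j k l :
  let N := 'X%:M - map_mx polyC M in
  lie_bracket (N i j) (N k l) = (lie_bracket (M i j) (M k l))%:P.
Proof.
have comm_Xn (p : {poly R}) m : GRing.comm ('X *+ m) p.
  by apply/commr_sym/commrMn; exact: commr_polyX.
rewrite /= !mxE lie_bracketDl_comm ?lie_bracketDr_comm//.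
by rewrite /lie_bracket !mulrNN polyCB !polyCM.
Qed.

Lemma manin_charmx n (M : 'M[R]_n) :
  manin M -> manin ('X%:M - map_mx polyC M).
Proof.
move=> [Mc Mx]; split=> [i j k|i j k l]; last by rewrite !lie_bracket_charmx Mx.
apply/eqP; rewrite -subr_eq0 -/(lie_bracket _ _) lie_bracket_charmx.
by rewrite /lie_bracket Mc subrr.
Qed.

Lemma deriv_prod_ord n (F : 'I_n -> {poly R}) :
  (\prod_(i < n) F i)^`() =
  \sum_(j < n) \prod_(i < n) (if i == j then (F i)^`() else F i).
Proof.
elim: n F => [|n IHn] F; first by rewrite !big_ord0 derivC.
rewrite big_ord_recr derivM IHn [RHS]big_ord_recr /=; congr (_ + _).
  rewrite mulr_suml; apply: eq_bigr => j _; rewrite big_ord_recr /=.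
  by rewrite -(inj_eq val_inj) /= gtn_eqF.
rewrite [RHS]big_ord_recr /= eqxx; congr (_ * _); apply: eq_bigr => i _.
by rewrite -(inj_eq val_inj) /= ltn_eqF.
Qed.

Lemma deriv_coldet n (N : 'M[{poly R}]_n) :
  (coldet N)^`() = \sum_j coldet (setcol j (fun i => (N i j)^`()) N).
Proof.
rewrite /coldet exchange_big raddf_sum; apply: eq_bigr => s _ /=.
rewrite -mulr_sumr !mulr_sign (fun_if (@deriv _)) derivN deriv_prod_ord.
suff -> : \sum_(j < n) \prod_(i < n)
    (if i == j then (N (s i) i)^`() else N (s i) i) =
  \sum_j \prod_i setcol j (fun i => (N i j)^`()) N (s i) i by [].
apply: eq_bigr => j _; apply: eq_bigr => i _; rewrite mxE.
by case: eqP => // ->.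
Qed.

(** Differentiating column [j] of [t - M] gives the basis vector [e_j], hence the diagonal entry
    [(j, j)] of the adjugate. *)
Lemma deriv_colchar n (M : 'M[R]_n) :
  (colchar_poly M)^`() = \tr (coladj ('X%:M - map_mx polyC M)).
Proof.
rewrite deriv_coldet; apply: eq_bigr => j _; rewrite mxE; congr coldet.
apply/matrixP => i l; rewrite !mxE; case: ifP => // _.
by rewrite derivB derivC subr0 derivMn derivX.
Qed.

Lemma size_prod_ord n (F : 'I_n -> {poly R}) :
  (forall i, size (F i) <= 2)%N -> (size (\prod_(i < n) F i)%R <= n.+1)%N.
Proof.
elim: n F => [|n IHn] F F2; first by rewrite big_ord0 size_poly1.
rewrite big_ord_recr /=; apply: (leq_trans (size_polyMleq _ _)).
have /= := IHn (fun i => F (widen_ord (leqnSn n) i)) (fun i => F2 _).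
by move: (F2 ord_max) (size _) => /=; move: (size (F ord_max)) => x x2 y; lia.
Qed.

Lemma size_colchar n (M : 'M[R]_n) : (size (colchar_poly M) <= n.+1)%N.
Proof.
apply: (leq_trans (size_sum _ _ _)); apply/bigmax_leqP => s _.
rewrite mulr_sign; set p := \prod_i _; suff p_size : (size p <= n.+1)%N.
  by case: ifP; rewrite ?size_polyN.
apply: size_prod_ord => i.
rewrite !mxE (leq_trans (size_polyD _ _))// geq_max size_polyN.
rewrite (leq_trans (size_polyC_leq1 _))// andbT.
by case: eqP; rewrite ?size_polyX ?size_poly0.
Qed.

(** * Polynomial coefficients indexed by integers *)

Lemma pcoef0 k : pcoef (0 : {poly R}) k = 0.
Proof. by case: k => // m; exact: coef0. Qed.

Lemma pcoefB (p q : {poly R}) k : pcoef (p - q) k = pcoef p k - pcoef q k.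
Proof. by case: k => m /=; rewrite ?coefB ?subr0. Qed.

Lemma pcoef_sum n (p : 'I_n -> {poly R}) k :
  pcoef (\sum_i p i) k = \sum_i pcoef (p i) k.
Proof. by case: k => m; [exact: coef_sum | rewrite /= big1]. Qed.

Lemma pcoefMn (p : {poly R}) m k : pcoef (p *+ m) k = pcoef p k *+ m.
Proof. by case: k => l /=; rewrite ?coefMn ?mul0rn. Qed.

Lemma pcoefMC (p : {poly R}) c k : pcoef (p * c%:P) k = pcoef p k * c.
Proof. by case: k => m /=; rewrite ?coefMC ?mul0r. Qed.

Lemma pcoefCM (p : {poly R}) c k : pcoef (c%:P * p) k = c * pcoef p k.
Proof. by case: k => m /=; rewrite ?coefCM ?mulr0. Qed.

Lemma pcoefMX (p : {poly R}) k : pcoef (p * 'X) k = pcoef p (k - 1).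
Proof.
case: k => [[|m]|m] //; first by rewrite /= coefMX.
have -> : m.+1%:Z - 1 = m by lia.
by rewrite /= coefMX.
Qed.

Lemma pcoef_size (p : {poly R}) k : (size p)%:Z <= k -> pcoef p k = 0.
Proof. by case: k => // m; exact: nth_default. Qed.

(** For [k <= 0] both sides are 0: the left by the default value at negative exponents, the right by
    that value or by the factor [k = 0]. *)
Lemma pcoef_deriv (p : {poly R}) k : pcoef p^`() (k - 1) = pcoef p k *~ k.
Proof.
case: k => [[|m]|m]; rewrite ?mulr0z//.
  have -> : m.+1%:Z - 1 = m by lia.
  by rewrite /= coef_deriv.
by rewrite /= mul0rz.
Qed.

Definition pcoef_mx n (A : 'M[{poly R}]_n) k : 'M[R]_n :=
  \matrix_(i, j) pcoef (A i j) k.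

Lemma pcoef_mx_bound n (A : 'M[{poly R}]_n) :
  exists D : nat, forall k, D%:Z <= k -> pcoef_mx A k = 0.
Proof.
exists (\max_(ij : 'I_n * 'I_n) size (A ij.1 ij.2))%N => k Dk.
apply/matrixP => i j; rewrite !mxE pcoef_size//; apply: le_trans Dk.
by rewrite lez_nat (leq_bigmax (i, j)).
Qed.

(* Writing [A = \sum_k A_k t^k], the hypothesis says that
   [A_(k-1) = P_k + A_k M]; unfold this recurrence. *)
Lemma newton_left n (M : 'M[R]_n) (A : 'M[{poly R}]_n) (P : {poly R}) :
    A *m ('X%:M - map_mx polyC M) = P%:M -> P^`() = \tr A ->
  forall k, exists d0, forall d, (d0 <= d)%N ->
    pcoef P k *~ k = \sum_(i < d) pcoef P (k + i%:Z) * \tr (M ^+ i).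
Proof.
move=> AP trA k; pose a := pcoef_mx A.
have aS l : a (l - 1) = (pcoef P l)%:M + a l * M.
  apply/eqP; rewrite -subr_eq; apply/eqP/matrixP => i j.
  have /(congr1 (fun p => pcoef p l)) := congr1 (fun B : 'M_n => B i j) AP.
  rewrite mulmxBr !mxE pcoefB !pcoef_sum pcoefMn => <-.
  rewrite [X in _ = X - _](bigD1 j)// [X in _ = _ + X - _]big1
    ?addr0 => [|m /negPf neq_m]; last first.
    by rewrite !mxE neq_m mulr0 pcoef0.
  rewrite !mxE eqxx pcoefMX; congr (_ - _); apply: eq_bigr => m _.
  by rewrite !mxE pcoefMC.
have aD d : a (k - 1) =
    \sum_(i < d) (pcoef P (k + i%:Z))%:M * M ^+ i + a (k - 1 + d%:Z) * M ^+ d.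
  elim: d => [|d ->]; first by rewrite big_ord0 add0r addr0 expr0 mulr1.
  rewrite big_ord_recr /= -[RHS]addrA; congr (_ + _).
  have -> : k - 1 + d%:Z = (k + d%:Z) - 1 by lia.
  by rewrite aS mulrDl -mulrA -exprS; congr (_ + a _ * _); lia.
have [D aD0] := pcoef_mx_bound A.
(* From this [d] on, [k - 1 + d >= D], so the remainder term of the unfolded recurrence vanishes. *)
exists (`|(k - 1)%R| + D)%N => d Dd; rewrite -pcoef_deriv trA pcoef_sum.
transitivity (\tr (a (k - 1))); first by apply: eq_bigr => i _; rewrite mxE.
rewrite (aD d) [a _]aD0 ?mul0r ?addr0; last by lia.
rewrite raddf_sum; apply: eq_bigr => i _ /=.
by rewrite -mulmxE mul_scalar_mx linearZ.
Qed.

(** Mirror image of [newton_left]: here [B_(k-1) = P_k + M B_k], so powers of [M] accumulate on the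
    left and the traces precede the coefficients. *)
Lemma newton_right n (M : 'M[R]_n) (B : 'M[{poly R}]_n) (P : {poly R}) :
    ('X%:M - map_mx polyC M) *m B = P%:M -> P^`() = \tr B ->
  forall k, exists d0, forall d, (d0 <= d)%N ->
    pcoef P k *~ k = \sum_(i < d) \tr (M ^+ i) * pcoef P (k + i%:Z).
Proof.
move=> BP trB k; pose b := pcoef_mx B.
have bS l : b (l - 1) = (pcoef P l)%:M + M * b l.
  apply/eqP; rewrite -subr_eq; apply/eqP/matrixP => i j.
  have /(congr1 (fun p => pcoef p l)) := congr1 (fun B : 'M_n => B i j) BP.
  rewrite mulmxBl !mxE pcoefB !pcoef_sum pcoefMn => <-.
  rewrite [X in _ = X - _](bigD1 i)// [X in _ = _ + X - _]big1
    ?addr0 => [|m /negPf neq_m]; last first.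
    by rewrite !mxE eq_sym neq_m mul0r pcoef0.
  rewrite !mxE eqxx -commr_polyX pcoefMX; congr (_ - _); apply: eq_bigr => m _.
  by rewrite !mxE pcoefCM.
have bD d : b (k - 1) =
    \sum_(i < d) M ^+ i * (pcoef P (k + i%:Z))%:M + M ^+ d * b (k - 1 + d%:Z).
  elim: d => [|d ->]; first by rewrite big_ord0 add0r addr0 expr0 mul1r.
  rewrite big_ord_recr /= -[RHS]addrA; congr (_ + _).
  have -> : k - 1 + d%:Z = (k + d%:Z) - 1 by lia.
  by rewrite bS mulrDr mulrA -exprSr; congr (_ + _ * b _); lia.
have [D bD0] := pcoef_mx_bound B.
exists (`|(k - 1)%R| + D)%N => d Dd; rewrite -pcoef_deriv trB pcoef_sum.
transitivity (\tr (b (k - 1))); first by apply: eq_bigr => i _; rewrite mxE.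
rewrite (bD d) [b _]bD0 ?mulr0 ?addr0; last by lia.
rewrite raddf_sum; apply: eq_bigr => i _ /=; rewrite /mxtrace mulr_suml.
apply: eq_bigr => j _; rewrite -[_ * _%:M]/(_ *m _%:M) mxE.
rewrite (bigD1 j)//= big1 ?addr0.
  by rewrite mxE eqxx.
by move=> m /negPf neq_m; rewrite mxE neq_m mulr0.
Qed.

Lemma newton_colchar n (M : 'M[R]_n) : manin M ->
  forall k, exists d0, forall d, (d0 <= d)%N ->
    pcoef (colchar_poly M) k *~ k =
    \sum_(i < d) pcoef (colchar_poly M) (k + i%:Z) * \tr (M ^+ i).
Proof.
move=> mM; apply: newton_left (deriv_colchar M).
exact/mul_coladj/manin_charmx.
Qed.

Lemma charmx_tr n (M : 'M[R]_n) :
  ('X%:M - map_mx polyC M)^T = 'X%:M - map_mx polyC M^T.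
Proof. by rewrite linearB /= tr_scalar_mx map_trmx. Qed.

Lemma rowchar_poly_tr n (M : 'M[R]_n) : rowchar_poly M = colchar_poly M^T.
Proof.
rewrite /colchar_poly -charmx_tr; apply: eq_bigr => s _; congr (_ * _).
by apply: eq_bigr => i _; rewrite [RHS]mxE.
Qed.

Lemma newton_rowchar n (M : 'M[R]_n) : manin M^T ->
  forall k, exists d0, forall d, (d0 <= d)%N ->
    pcoef (rowchar_poly M) k *~ k =
    \sum_(i < d) \tr (M ^+ i) * pcoef (rowchar_poly M) (k + i%:Z).
Proof.
move=> mM; rewrite rowchar_poly_tr; set N := 'X%:M - map_mx polyC M^T.
apply: (@newton_right _ _ (coladj N)^T); last by rewrite mxtrace_tr deriv_colchar.
(* [t - M] is the transpose of [N = t - M^T], so the transposed Cramer identity for [N] applies. *)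
rewrite -[M in X in X *m _]trmxK -charmx_tr; exact/mul_tr_coladj/manin_charmx.
Qed.

End CharPoly.

(** * Coefficients of the Laurent series in the trace formula *)

Section LaurentCoef.
Variable R : nzRingType.
Implicit Types (f g : laurent R) (p : {poly R}).

Lemma lcoef_sum n (F : 'I_n -> laurent R) k : (\sum_i F i) k = \sum_i F i k.
Proof. by elim/big_ind2: _ => // _ f _ g <- <-. Qed.

Lemma lpolyE p k : lpoly p k = pcoef p k.
Proof.
rewrite /lpoly lcoef_insubd//; apply/bounded_aboveP; exists (size p)%:Z => l pl.
exact/pcoef_size/ltW.
Qed.

Lemma lvarM k f m : (lvar R k * f) m = f (m - k).
Proof.
rewrite -[_ * f]/(lmul _ f) lmulE /lmul_coef (fsbigE [:: k])//= => [|i _].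
  by rewrite big_cons big_nil in_setT lvarE eqxx mul1r addr0.
by rewrite inE lvarE => /negPf ->; rewrite mul0r.
Qed.

Lemma lconstM c f m : (lconst c * f) m = c * f m.
Proof.
rewrite -[_ * f]/(lmul _ f) lmulE /lmul_coef (fsbigE [:: 0])//= => [|i _].
  by rewrite big_cons big_nil in_setT lpolyE /= coefC subr0 addr0.
by rewrite inE lpolyE; case: i => [[|i]|i]//= _; rewrite ?coefC mul0r.
Qed.

(** [(M/t)^d] is concentrated in degree [-d], since [1/t] is central. *)
Lemma mx_over_tXE n (M : 'M[R]_n) d i j m :
  (mx_over_t M ^+ d) i j m = (M ^+ d) i j *+ (m == - d%:Z).
Proof.
elim: d i j m => [|d IHd] i j m.
  have oneE (S : pzRingType) : (1 : 'M[S]_n) i j = (i == j)%:R by exact: mxE.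
  rewrite !expr0 !oneE oppr0; case: (i == j); last by rewrite mul0rn.
  by rewrite mulr1n -[1]/(lvar R 0) lvarE.
rewrite !exprS -!mulmxE !mxE lcoef_sum -sumrMnl; apply: eq_bigr => l _.
rewrite !mxE -mulrA lvarM lconstM IHd mulrnAr; congr (_ *+ _).
by congr (nat_of_bool _); apply/eqP/eqP; lia.
Qed.

Lemma lsum_trace_mx_over_tE n (M : 'M[R]_n) k :
  lsum (fun d => \tr (mx_over_t M ^+ d)) k =
  if k <= 0 then \tr (M ^+ `|k|%N) else 0.
Proof.
set T := fun k : int => if k <= 0 then \tr (M ^+ `|k|%N) else 0.
(* Identifying the coefficient function with the explicit [T] first reduces the boundedness
   condition of [insubd] to that of [T]. *)
suff -> : lsum (fun d => \tr (mx_over_t M ^+ d)) = insubd 0 T.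
  rewrite lcoef_insubd//; apply/bounded_aboveP; exists 0 => l.
  by rewrite /T ltNge => /negPf ->.
congr insubd; apply/funext => l; rewrite /T.
have trE d : \tr (mx_over_t M ^+ d) l = \tr (M ^+ d) *+ (l == - d%:Z).
  by rewrite lcoef_sum -sumrMnl; apply: eq_bigr => i _; exact: mx_over_tXE.
case: ifP => [l_le0|l_gt0]; last first.
  by apply: fsbig1 => d _; rewrite trE; case: eqP => // ld; lia.
rewrite (fsbigE [:: `|l|%N])//= => [|d _].
  rewrite big_cons big_nil in_setT trE addr0.
  by have -> : l == - `|l|%N%:Z by apply/eqP; lia.
rewrite inE trE => d_neq; case: eqP => // ld.
by rewrite ld abszN eqxx in d_neq.
Qed.

(** The Cauchy product is reindexed by the exponents [k + i] of [p]; the bound on [d] ensures that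
    [p] has no coefficient at [k + i] once [i >= d]. *)
Lemma lpolyM_trace n (M : 'M[R]_n) p k d : (size p + `|k| <= d)%N ->
  (lpoly p * lsum (fun l => \tr (mx_over_t M ^+ l))) k =
  \sum_(i < d) pcoef p (k + i%:Z) * \tr (M ^+ i).
Proof.
move=> pkd; rewrite -[_ * _]/(lmul _ _) lmulE /lmul_coef.
rewrite (fsbigE [seq k + (i : nat)%:Z | i <- index_iota 0 d])//.
- rewrite big_map big_mkord; apply: eq_big => [i|i _]; first by rewrite in_setT.
  rewrite lpolyE lsum_trace_mx_over_tE.
  have -> : k - (k + i%:Z) = - i%:Z by lia.
  by rewrite oppr_le0 abszN.
- by rewrite map_inj_uniq ?iota_uniq// => x y /addrI[].
move=> i _; apply: contraNeq; rewrite lpolyE lsum_trace_mx_over_tE.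
case: ifP => [ki pi|_]; last by rewrite mulr0 eqxx.
apply/mapP; exists `|(i - k)%R|%N; last by lia.
rewrite mem_index_iota /=; move: pi; have [pi _|pi] := ltP i (size p)%:Z.
  by lia.
by rewrite pcoef_size ?mul0r ?eqxx.
Qed.

(** With the factors exchanged, the reindexing runs over the exponents [-i] of the trace series. *)
Lemma traceM_lpoly n (M : 'M[R]_n) p k d : (size p + `|k| <= d)%N ->
  (lsum (fun l => \tr (mx_over_t M ^+ l)) * lpoly p) k =
  \sum_(i < d) \tr (M ^+ i) * pcoef p (k + i%:Z).
Proof.
move=> pkd; rewrite -[_ * _]/(lmul _ _) lmulE /lmul_coef.
rewrite (fsbigE [seq - (i : nat)%:Z | i <- index_iota 0 d])//.
- rewrite big_map big_mkord; apply: eq_big => [i|i _]; first by rewrite in_setT.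
  by rewrite lpolyE lsum_trace_mx_over_tE oppr_le0 abszN opprK.
- by rewrite map_inj_uniq ?iota_uniq// => x y /oppr_inj[].
move=> i _; apply: contraNeq; rewrite lpolyE lsum_trace_mx_over_tE.
case: ifP => [i_le0 pi|_]; last by rewrite mul0r eqxx.
apply/mapP; exists `|i|%N; last by lia.
rewrite mem_index_iota /=; move: pi; have [pi _|pi] := ltP (k - i) (size p)%:Z.
  by lia.
by rewrite pcoef_size ?mulr0 ?eqxx.
Qed.

Lemma pcoef_expand p n : (size p <= n)%N ->
  p = \sum_(k < n) (pcoef p k%:Z)%:P * 'X^k.
Proof.
move=> pn; rewrite -[LHS](take_poly_id pn) /take_poly poly_def.
by apply: eq_bigr => i _; rewrite mul_polyC.
Qed.

End LaurentCoef.

(** The Newton sum holds for all large upper bounds; it is cut down to the window where the exponent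
    [k + i] lies between 0 and [n]. *)
Lemma colchar_poly_trace (R : nzRingType) n (M : 'M[R]_n) (k : int) :
    manin M -> k <= n%:Z ->
  pcoef (colchar_poly M) k *~ k =
  \sum_(0 <= i < (absz (n%:Z - k)%R).+1 | - k <= i%:Z)
    pcoef (colchar_poly M) (k + i%:Z) * \tr (M ^+ i).
Proof.
move=> mM kn; have [d0 Pd] := newton_colchar mM k.
set F := fun i : nat => pcoef (colchar_poly M) (k + i%:Z) * \tr (M ^+ i).
(* Below the window the exponent is negative, where [pcoef] is 0; above it the exponent exceeds the
   degree bound [n]. *)
have F0 (i : nat) : ~~ (- k <= i%:Z <= n%:Z - k) -> F i = 0.
  rewrite /F negb_and -!ltNge => /orP[ik|ik].
    have [m ->] : exists m, k + i%:Z = Negz m by exists `|k + i%:Z|.-1; lia.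
    by rewrite mul0r.
  rewrite pcoef_size ?mul0r//.
  by apply: (@le_trans _ _ n.+1%:Z); [rewrite lez_nat size_colchar | lia].
set e := `|(n%:Z - k)%R|.+1.
have [ed0 ed] : (d0 <= d0 + e)%N /\ (e <= d0 + e)%N by lia.
rewrite (Pd _ ed0) -(big_mkord xpredT F) (big_cat_nat _ ed)//=.
rewrite [X in _ + X]big_nat.
rewrite [X in _ + X]big1 => [|i /andP[ei _]]; last by apply: F0; lia.
rewrite addr0 big_mkcond [RHS]big_mkcond; apply: eq_bigr => i _.
by case: ifP => // ik; rewrite F0// ik.
Qed.

Theorem theorem4 (K : realType) (R : algType K[i]) (n : nat) (M : 'M[R]_n) :
  (manin M ->
     let P := colchar_poly M in
     let h := pcoef P in
     [/\ P = \sum_(k < n.+1) (h k%:Z)%:P * 'X^k,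
         lpoly P^`() =
           lvar R (-1) * lpoly P * lsum (fun k => \tr (mx_over_t M ^+ k))
       & forall k : int, k <= n%:Z ->
           h k *~ k =
             \sum_(0 <= i < (absz (n%:Z - k)%R).+1 | - k <= i%:Z)
               h (k + i%:Z) * \tr (M ^+ i)])
  /\
  (manin M^T ->
     let Q := rowchar_poly M in
     lpoly Q^`() =
       lvar R (-1) * lsum (fun k => \tr (mx_over_t M ^+ k)) * lpoly Q).
Proof.
split=> mM.
  split=> [||k]; last exact: colchar_poly_trace.
    exact/pcoef_expand/size_colchar.
  (* The factor [1/t] shifts the exponent, so the coefficient of [t^k] on both sides is given by the
     Newton identity at [k + 1]. *)
  apply: laurentP => k; rewrite -mulrA lvarM opprK lpolyE.
  have := pcoef_deriv (colchar_poly M) (k + 1); rewrite addrK => ->.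
  have [d0 Pd] := newton_colchar mM (k + 1).
  (* Adding [d0] to the bound of the product formula gives one [d] large enough for both sums. *)
  rewrite (lpolyM_trace _ (leq_addl d0 _)); apply: Pd; exact: leq_addr.
apply: laurentP => k; rewrite -mulrA lvarM opprK lpolyE.
have := pcoef_deriv (rowchar_poly M) (k + 1); rewrite addrK => ->.
have [d0 Qd] := newton_rowchar mM (k + 1).
rewrite (traceM_lpoly _ (leq_addl d0 _)); apply: Qd; exact: leq_addr.
Qed.
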